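(* For all graphs $\tau,\Lambda\in\mathcal G$: \begin{align*} \langle\mathtt{GC}^{\mathrm{mono}}(\Lambda),\tau\rangle&=\langle\mathtt{GC}^{\mathrm{regmono}}(\Lambda),\Phi_{\mathrm{regmono}\leftarrow\mathrm{mono}}(\tau)\rangle,\\ \langle\mathtt{GC}^{\mathrm{hom}}(\Lambda),\tau\rangle&=\langle\mathtt{GC}^{\mathrm{mono}}(\Lambda),\Phi_{\mathrm{mono}\leftarrow\mathrm{hom}}(\tau)\rangle,\\ \langle\mathtt{GC}^{\mathrm{hom}}(\Lambda),\tau\rangle&=\langle\mathtt{GC}^{\mathrm{regmono}}(\Lambda),\Phi_{\mathrm{regmono}\leftarrow\mathrm{mono}}\circ\Phi_{\mathrm{mono}\leftarrow\mathrm{hom}}(\tau)\rangle,\\ \langle\mathtt{GC}^{\mathrm{hom}}(\Lambda),\tau\rangle&=\langle\mathtt{GC}^{\mathrm{hom}'}(\Lambda),\Phi_{\mathrm{hom}'\leftarrow\mathrm{hom}}(\tau)\rangle,\\ \langle\mathtt{GC}^{\mathrm{mono}}(\Lambda),\tau\rangle&=\langle\mathtt{GC}^{\mathrm{mono}'}(\Lambda),\Phi_{\mathrm{mono}'\leftarrow\mathrm{mono}}(\tau)\rangle,\\ \langle\mathtt{GC}^{\mathrm{regmono}}(\Lambda),\tau\rangle&=\langle\mathtt{GC}^{\mathrm{regmono}'}(\Lambda),\Phi_{\mathrm{regmono}'\leftarrow\mathrm{regmono}}(\tau)\rangle. \end{align*}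
   Context: Graphs are finite simple graphs (isolated vertices allowed, no loops, no parallel edges). $\mathrm{Hom}(\sigma,\tau)$ is the set of graph homomorphisms (maps $V(\sigma)\to V(\tau)$ sending edges to edges); $\mathrm{Mono}(\sigma,\tau)$ those injective on vertices; $\mathrm{RegMono}(\sigma,\tau)$ those that are isomorphisms onto the subgraph of $\tau$ induced by the image of $V(\sigma)$; $\mathrm{Epi}(\sigma,\tau)$ those surjective on vertices; $\mathrm{RegEpi}(\sigma,\tau)$ those surjective on vertices and on edges; $\mathrm{Aut}(\sigma)$ is the automorphism group. $\mathcal G$ is the set of isomorphism classes of graphs and $\langle\mathcal G\rangle_{\mathbb Q}$ the $\mathbb Q$-vector space with basis $\mathcal G$. For a graph $\Lambda$, the functionals $\mathtt{GC}^{x}(\Lambda)$ on $\langle\mathcal G\rangle_{\mathbb Q}$ are linear, with values at $\sigma\in\mathcal G$: $|\mathrm{Hom}(\sigma,\Lambda)|$ for $x=\mathrm{hom}$; $|\mathrm{Mono}(\sigma,\Lambda)|$ for $x=\mathrm{mono}$; $|\mathrm{RegMono}(\sigma,\Lambda)|$ for $x=\mathrm{regmono}$; and for $x=\mathrm{hom}',\mathrm{mono}',\mathrm{regmono}'$ the same numbers divided by $|\mathrm{Aut}(\sigma)|$. $\langle f,x\rangle$ is the value of $f$ at $x$. Linear maps $\langle\mathcal G\rangle_{\mathbb Q}\to\langle\mathcal G\rangle_{\mathbb Q}$ given on $\tau\in\mathcal G$ (sums over $\sigma\in\mathcal G$): $\Phi_{\mathrm{regmono}\leftarrow\mathrm{mono}}(\tau)=\sum_\sigma\frac{|\mathrm{Mono}(\tau,\sigma)\cap\mathrm{Epi}(\tau,\sigma)|}{|\mathrm{Aut}(\sigma)|}\sigma$;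 $\ \Phi_{\mathrm{mono}\leftarrow\mathrm{hom}}(\tau)=\sum_\sigma\frac{|\mathrm{RegEpi}(\tau,\sigma)|}{|\mathrm{Aut}(\sigma)|}\sigma$; $\ \Phi_{\mathrm{hom}'\leftarrow\mathrm{hom}}(\tau)=\Phi_{\mathrm{mono}'\leftarrow\mathrm{mono}}(\tau)=\Phi_{\mathrm{regmono}'\leftarrow\mathrm{regmono}}(\tau)=|\mathrm{Aut}(\tau)|\,\tau$. *)

(* Defs.v *)
From HB Require Import structures.
From mathcomp Require Import all_boot all_order all_algebra.
From mathcomp Require Import generic_quotient freeg.
From mathcomp Require Import classical_sets fsbigop.

Set Implicit Arguments.
Unset Strict Implicit.
Unset Printing Implicit Defensive.

Import GRing.Theory.

Local Open Scope quotient_scope.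

(* Since only isomorphism classes matter, vertex sets are taken among the
   initial segments 'I_n: every finite simple graph is isomorphic to such a
   graph. Edges are 2-element sets of vertices. *)
Record graph_on (n : nat) := GraphOn {
  edge_set : {set {set 'I_n}};
  _ : [forall e in edge_set, #|e| == 2] }.

HB.instance Definition _ n := [isSub for @edge_set n].
HB.instance Definition _ n := [Finite of graph_on n by <:].

Definition graph : Type := {n : nat & graph_on n}.
HB.instance Definition _ := Choice.on graph.

Definition vertex (s : graph) : finType := 'I_(tag s).
Definition edges (s : graph) : {set {set vertex s}} := edge_set (tagged s).

Notation vmap s t := {ffun vertex s -> vertex t}.

Definition edge_image (s t : graph) (f : vmap s t) : {set {set vertex t}} :=
  [set f @: (e : {set vertex s}) | e in edges s].

Definition vertex_image (s t : graph) (f : vmap s t) : {set vertex t} :=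
  f @: [set: vertex s].

Definition Hom (s t : graph) : {set vmap s t} :=
  [set f : vmap s t | edge_image f \subset edges t].

Definition Mono (s t : graph) : {set vmap s t} :=
  [set f : vmap s t in Hom s t | injectiveb f].

(* [edges t ::&: A] is the edge set of the subgraph of [t] induced by [A]. *)
Definition RegMono (s t : graph) : {set vmap s t} :=
  [set f : vmap s t |
    injectiveb f & edge_image f == edges t ::&: vertex_image f].

Definition Epi (s t : graph) : {set vmap s t} :=
  [set f : vmap s t in Hom s t | vertex_image f == [set: vertex t]].

Definition RegEpi (s t : graph) : {set vmap s t} :=
  [set f : vmap s t in Epi s t | edge_image f == edges t].

Definition Iso (s t : graph) : {set vmap s t} :=
  [set f : vmap s t |
    [&& injectiveb f, vertex_image f == [set: vertex t] & edge_image f == edges t]].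

Definition Aut (s : graph) : {set vmap s s} := Iso s s.

Definition isomorphic (s t : graph) : bool := [exists f, f \in Iso s t].

Lemma isomorphicP (s t : graph) :
  reflect (exists2 f : vertex s -> vertex t, bijective f &
             forall e : {set vertex s}, (f @: e \in edges t) = (e \in edges s))
          (isomorphic s t).
Proof.
apply: (iffP existsP) => [[f]|[f [g fK gK] fE]].
  rewrite inE => /and3P[/injectiveP f_inj /eqP fT /eqP fE]; exists f.
    have f_surj y : exists x, f x == y.
      have : y \in vertex_image f by rewrite fT inE.
      by case/imsetP => x _ ->; exists x.
    exists (fun y => xchoose (f_surj y)) => [x|y].
      by apply: f_inj; exact: (eqP (xchooseP (f_surj _))).
    exact: (eqP (xchooseP (f_surj _))).
  move=> e; rewrite -fE /edge_image.
  by rewrite (mem_imset _ _ (imset_inj f_inj)).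
exists [ffun x => f x]; rewrite inE.
have fI (e : {set vertex s}) : [ffun x => f x] @: e = f @: e.
  by apply: eq_imset => x; rewrite ffunE.
apply/and3P; split.
- by apply/injectiveP => x y; rewrite !ffunE => /(can_inj fK).
- rewrite /vertex_image fI; apply/eqP/setP => y; rewrite !inE.
  by apply/imsetP; exists (g y); rewrite ?inE ?gK.
apply/eqP/setP => e; rewrite /edge_image; apply/imsetP/idP.
  by case=> d dE ->; rewrite fI fE.
have eK : e = f @: (g @: e) by rewrite -imset_comp (eq_imset _ gK) imset_id.
by move=> eE; exists (g @: e); rewrite ?fI // -fE -eK.
Qed.

Lemma isomorphic_refl : reflexive isomorphic.
Proof.
move=> s; apply/isomorphicP; exists id; first by exists id.
by move=> e; rewrite imset_id.
Qed.

Lemma isomorphic_sym : symmetric isomorphic.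
Proof.
suff impl s t : isomorphic s t -> isomorphic t s.
  by move=> s t; apply/idP/idP; apply: impl.
case/isomorphicP => f [g fK gK] fE; apply/isomorphicP.
exists g; first by exists f.
by move=> e; rewrite -fE -imset_comp (eq_imset _ gK) imset_id.
Qed.

Lemma isomorphic_trans : transitive isomorphic.
Proof.
move=> t s u /isomorphicP[f f_bij fE] /isomorphicP[g g_bij gE].
apply/isomorphicP; exists (g \o f); first exact: bij_comp.
by move=> e; rewrite imset_comp gE fE.
Qed.

Canonical isomorphic_equiv :=
  EquivRel isomorphic isomorphic_refl isomorphic_sym isomorphic_trans.

(* Isomorphism classes of graphs. The numbers of morphisms below are
   isomorphism invariant, so they are evaluated on [repr]esentatives. *)
Definition graph_class : Type := {eq_quot isomorphic}.
HB.instance Definition _ := Choice.on graph_class.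
HB.instance Definition _ := Quotient.on graph_class.

Definition n_hom (s t : graph_class) : nat := #|Hom (repr s) (repr t)|.
Definition n_mono (s t : graph_class) : nat := #|Mono (repr s) (repr t)|.
Definition n_regmono (s t : graph_class) : nat := #|RegMono (repr s) (repr t)|.
Definition n_monoepi (s t : graph_class) : nat :=
  #|Mono (repr s) (repr t) :&: Epi (repr s) (repr t)|.
Definition n_regepi (s t : graph_class) : nat := #|RegEpi (repr s) (repr t)|.
Definition n_aut (s : graph_class) : nat := #|Aut (repr s)|.

Local Open Scope ring_scope.

Definition QG : Type := {freeg graph_class / rat}.
HB.instance Definition _ := GRing.Lmodule.on QG.

Definition basis (s : graph_class) : QG := << s >>.

(* [fglift f] is the linear extension of [f] from the basis. *)
Lemma fglift_is_linear (M : lmodType rat) (f : graph_class -> M) :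
  linear (fglift f : QG -> M).
Proof.
have fB : {morph fglift f : x y / x - y} by exact: lift_is_additive.
have f0 : fglift f 0 = 0 by rewrite -(subrr 0) fB subrr.
have fN : {morph fglift f : x / - x} by move=> x; rewrite -sub0r fB f0 sub0r.
have fD : {morph fglift f : x y / x + y}.
  by move=> x y; rewrite -{1}[y]opprK fB fN opprK.
have fS (I : Type) (r : seq I) (F : I -> QG) :
    fglift f (\sum_(i <- r) F i) = \sum_(i <- r) fglift f (F i).
  exact: (big_morph _ fD f0).
move=> c x y; rewrite fD; congr (_ + _).
rewrite (_ : fglift f x = \sum_(z <- dom x) fglift f << coeff z x *g z >>);
  last by rewrite -fS freeg_sumE.
rewrite scaler_sumr.
rewrite (_ : c *: x = \sum_(z <- dom x) << c * coeff z x *g z >>) // fS.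
by apply: eq_bigr => z _; rewrite !liftU scalerA.
Qed.

Definition lin_ext (M : lmodType rat) (f : graph_class -> M) : QG -> M :=
  fglift f.
HB.instance Definition _ (M : lmodType rat) (f : graph_class -> M) :=
  GRing.isLinear.Build rat QG M _ (lin_ext f) (fglift_is_linear f).

Definition functional : Type := {linear QG -> rat^o}.

Definition GC_hom (L : graph_class) : functional :=
  lin_ext (fun s => (n_hom s L)%:R : rat^o).
Definition GC_mono (L : graph_class) : functional :=
  lin_ext (fun s => (n_mono s L)%:R : rat^o).
Definition GC_regmono (L : graph_class) : functional :=
  lin_ext (fun s => (n_regmono s L)%:R : rat^o).
Definition GC_hom' (L : graph_class) : functional :=
  lin_ext (fun s => (n_hom s L)%:R / (n_aut s)%:R : rat^o).
Definition GC_mono' (L : graph_class) : functional :=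
  lin_ext (fun s => (n_mono s L)%:R / (n_aut s)%:R : rat^o).
Definition GC_regmono' (L : graph_class) : functional :=
  lin_ext (fun s => (n_regmono s L)%:R / (n_aut s)%:R : rat^o).

Definition pairing (phi : functional) (x : QG) : rat := phi x.

(* The sums over all classes have finite support: a class contributing to the
   image of [t] has at most as many vertices as [t]. *)
Definition Phi_regmono_mono : {linear QG -> QG} :=
  lin_ext (fun t : graph_class =>
    \sum_(s \in [set: graph_class]%classic)
      ((n_monoepi t s)%:R / (n_aut s)%:R : rat) *: basis s).
Definition Phi_mono_hom : {linear QG -> QG} :=
  lin_ext (fun t : graph_class =>
    \sum_(s \in [set: graph_class]%classic)
      ((n_regepi t s)%:R / (n_aut s)%:R : rat) *: basis s).
Definition Phi_hom'_hom : {linear QG -> QG} :=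
  lin_ext (fun t : graph_class => ((n_aut t)%:R : rat) *: basis t).
Definition Phi_mono'_mono : {linear QG -> QG} := Phi_hom'_hom.
Definition Phi_regmono'_regmono : {linear QG -> QG} := Phi_hom'_hom.

(* Main.v *)
(* Every homomorphism f : t -> L factors as f = m \o e with e onto and m
   injective: either through the subgraph (f(V), f(E)), with e a regular epi and
   m mono, or, when f is mono, through the subgraph induced on f(V), with m a
   regular mono. The middle graph s is unique up to isomorphism. As m is
   injective and e is onto, a factorization through a fixed s amounts to an
   isomorphism m from s onto the subgraph concerned, and Aut(s) acts simply
   transitively on these. Hence the sum over s of |{e}| |{m}| / |Aut(s)| counts
   each f exactly once. *)

From mathcomp Require Import classical_sets fsbigop.
From mathcomp Require Import all_boot all_order all_algebra.
From mathcomp Require Import generic_quotient freeg.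
Require Import Defs.

Set Implicit Arguments.
Unset Strict Implicit.
Unset Printing Implicit Defensive.

Import GRing.Theory.

Local Open Scope quotient_scope.

(** * Composition of vertex maps and factoring through an injective map *)

Definition comp_vmap (s t u : graph) (f : vmap s t) (g : vmap t u) : vmap s u :=
  [ffun x => g (f x)].

Lemma imset_comp_vmap (s t u : graph) (f : vmap s t) (g : vmap t u)
    (e : {set vertex s}) :
  comp_vmap f g @: e = g @: (f @: e).
Proof. by rewrite -imset_comp; apply: eq_imset => x; rewrite ffunE. Qed.

Lemma vertex_image_comp (s t u : graph) (f : vmap s t) (g : vmap t u) :
  vertex_image (comp_vmap f g) = g @: vertex_image f.
Proof. exact: imset_comp_vmap. Qed.

Lemma edge_image_comp (s t u : graph) (f : vmap s t) (g : vmap t u) :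
  edge_image (comp_vmap f g) = [set g @: (e : {set vertex t}) | e in edge_image f].
Proof.
rewrite /edge_image -imset_comp; apply: eq_imset => e.
exact: imset_comp_vmap.
Qed.

Lemma edge_image_sub (s t : graph) (f : vmap s t) (e : {set vertex t}) :
  e \in edge_image f -> e \subset vertex_image f.
Proof. by case/imsetP => d _ ->; apply: imsetS; apply: subsetT. Qed.

Lemma card_edge (s : graph) (e : {set vertex s}) : e \in edges s -> #|e| = 2.
Proof.
rewrite /edges; case: (tagged s) => E /= /forallP/(_ e)/implyP He /He.
by move/eqP.
Qed.

(* Any map whose image lies in that of an injective one factors through it. *)
Lemma factor_through (s t u : graph) (f : vmap s u) (g : vmap t u) :
    vertex_image f \subset vertex_image g ->
  exists h : vmap s t, comp_vmap h g = f.
Proof.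
move/subsetP => fg.
have lift x : exists y, g y == f x.
  have /fg/imsetP[y _ ->] : f x \in vertex_image f by apply: imset_f; rewrite inE.
  by exists y.
exists [ffun x => xchoose (lift x)]; apply/ffunP => x; rewrite !ffunE.
exact: (eqP (xchooseP (lift x))).
Qed.

(** * Embeddings onto a prescribed subgraph *)

(* The isomorphisms from [s] onto the subgraph [(A, D)] of [t]. *)
Definition Emb (s t : graph) (A : {set vertex t}) (D : {set {set vertex t}})
    : {set vmap s t} :=
  [set f : vmap s t |
    [&& injectiveb f, vertex_image f == A & edge_image f == D]].

Lemma EmbP (s t : graph) (A : {set vertex t}) (D : {set {set vertex t}})
    (f : vmap s t) :
  reflect [/\ injective f, vertex_image f = A & edge_image f = D]
          (f \in Emb s A D).
Proof.
rewrite inE; apply: (iffP and3P) => [[/injectiveP ? /eqP ? /eqP ?]|[? -> ->]] //.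
by split=> //; apply/injectiveP.
Qed.

Arguments EmbP {s t A D f}.

Lemma Iso_EmbE (s t : graph) : Iso s t = Emb s [set: vertex t] (edges t).
Proof. by []. Qed.

Lemma comp_vmap_inj (s t u : graph) (g : vmap t u) :
  injective g -> injective (fun f : vmap s t => comp_vmap f g).
Proof.
move=> g_inj f f' /ffunP ff'; apply/ffunP => x; apply: g_inj.
by have := ff' x; rewrite !ffunE.
Qed.

(** An injective [g] acts injectively on sets of vertices and on sets of edges, so it cancels from
    both image conditions. *)
Lemma Emb_comp (s t u : graph) (A : {set vertex u}) (D : {set {set vertex u}})
    (f : vmap s t) (g : vmap t u) :
  g \in Emb t A D -> (comp_vmap f g \in Emb s A D) = (f \in Iso s t).
Proof.
case/EmbP => g_inj gA gD; rewrite Iso_EmbE; apply/EmbP/EmbP.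
  case=> fg_inj; rewrite vertex_image_comp edge_image_comp -gA -gD => fgA fgD.
  split; last exact: (imset_inj (imset_inj g_inj)).
    by move=> x y fxy; apply: fg_inj; rewrite !ffunE fxy.
  exact: (imset_inj g_inj).
case=> f_inj fT fE; rewrite vertex_image_comp edge_image_comp fT fE.
by split=> // x y; rewrite !ffunE => /g_inj/f_inj.
Qed.

(** This is the uniqueness of the middle graph: [f] factors through [g], and [Emb_comp] makes the
    connecting map an isomorphism. *)
Lemma Emb_isomorphic (s s' t : graph) (A : {set vertex t})
    (D : {set {set vertex t}}) (f : vmap s t) (g : vmap s' t) :
  f \in Emb s A D -> g \in Emb s' A D -> isomorphic s s'.
Proof.
move=> fE gE; have [_ fA _] := EmbP fE; have [_ gA _] := EmbP gE.
have [|h hE] := @factor_through s s' t f g; first by rewrite fA gA.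
by apply/existsP; exists h; rewrite -(Emb_comp _ gE) hE.
Qed.

(** Composition with the fixed [f] maps [Aut s] bijectively onto the embeddings; this is the simple
    transitivity of the action. *)
Lemma card_Emb (s t : graph) (A : {set vertex t}) (D : {set {set vertex t}})
    (f : vmap s t) :
  f \in Emb s A D -> #|Emb s A D| = #|Aut s|.
Proof.
move=> fE; have [f_inj fA _] := EmbP fE.
rewrite -(card_imset _ (comp_vmap_inj (s := s) f_inj)); congr #|pred_of_set _|.
apply/setP => g; apply/idP/imsetP => [gE|[h hA ->]]; last by rewrite Emb_comp.
have [_ gA _] := EmbP gE.
have [|h hE] := @factor_through s s t g f; first by rewrite fA gA.
by exists h => //; rewrite -(Emb_comp _ fE) hE.
Qed.

Lemma card_Aut_gt0 (s : graph) : (0 < #|Aut s|)%N.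
Proof.
apply/card_gt0P.
by have /existsP := isomorphic_refl s.
Qed.

Lemma subgraph_edgesP (t : graph) (A : {set vertex t})
    (D : {set {set vertex t}}) :
  D \subset edges t ->
  [forall e in [set e : {set 'I_#|A|} | [set enum_val i | i in e] \in D],
    #|e| == 2].
Proof.
move/subsetP => DE; apply/forallP => e; apply/implyP; rewrite inE => /DE/card_edge.
by rewrite card_imset; [move-> | exact: enum_val_inj].
Qed.

(** The vertices in [A] are renumbered by [enum_val], which gives a graph on ['I_#|A|]. An
    isomorphism from the representative of its class is then composed with the renumbering. *)
Lemma Emb_exists (t : graph) (A : {set vertex t}) (D : {set {set vertex t}}) :
    D \subset edges t -> {in D, forall e : {set vertex t}, e \subset A} ->
  exists s : graph_class, exists f, f \in Emb (repr s) A D.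
Proof.
move=> DE DA.
pose s : graph := Tagged graph_on (GraphOn (subgraph_edgesP A DE)).
pose m : vmap s t := [ffun i : 'I_#|A| => enum_val i].
have mI (e : {set 'I_#|A|}) : m @: e = [set enum_val i | i in e].
  by apply: eq_imset => i; rewrite ffunE.
(* Every subset of [A] is the image of its preimage under the numbering. This serves for [A] itself
   and for each edge in [D]. *)
have rngA (e : {set vertex t}) : e \subset A -> exists d : {set 'I_#|A|}, m @: d = e.
  move=> /subsetP eA; exists [set i | enum_val i \in e]; rewrite mI.
  apply/setP => x; apply/imsetP/idP => [[i]|xe]; first by rewrite inE => ? ->.
  exists (enum_rank_in (eA x xe) x); rewrite ?inE enum_rankK_in ?eA //.
have mE : m \in Emb s A D.
  apply/EmbP; split.
  - by move=> i j; rewrite !ffunE => /enum_val_inj.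
  - apply/eqP; rewrite eqEsubset; apply/andP; split.
      by apply/subsetP => x /imsetP[i _ ->]; rewrite ffunE; exact: enum_valP.
    by have [d <-] := rngA A (subxx A); apply: imsetS; apply: subsetT.
  - apply/setP => e; apply/imsetP/idP => [[d]|eD].
      by rewrite inE -mI => dD ->.
    by have [d dE] := rngA e (DA e eD); exists d; rewrite // inE -mI dE.
exists (\pi_graph_class s).
have /existsP[h hI] : isomorphic (repr (\pi_graph_class s)) s.
  by apply/eqmodP; rewrite reprK.
by exists (comp_vmap h m); rewrite Emb_comp.
Qed.

(** * Double counting of factorizations *)

(** Pairs [(e, m)] are counted by their composite [f]: [m] determines [e] once [f] is fixed, and the
    admissible [m] are the embeddings onto the subgraph with edge set [D f]. Keeping [D] abstract
    covers both the induced edges and the edge image. *)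
Lemma card_factorizations (t s u : graph) (E : {set vmap t s})
    (M : {set vmap s u}) (H : {set vmap t u})
    (D : vmap t u -> {set {set vertex u}}) :
    {in M, forall m : vmap s u, injective m} ->
    {in E & M, forall e m, comp_vmap e m \in H} ->
    {in H, forall f m, m \in Emb s (vertex_image f) (D f) <->
       m \in M /\ exists2 e, e \in E & comp_vmap e m = f} ->
  (#|E| * #|M| = \sum_(f in H) #|Emb s (vertex_image f) (D f)|)%N.
Proof.
move=> M_inj EMH EmbE; rewrite mulnC -sum_nat_const.
pose EM (m : vmap s u) := [set comp_vmap e m | e : vmap t s in E].
(* As [m] is injective, [e] is recovered from its composite with [m]. *)
have cardEM m : m \in M -> #|E| = (\sum_(f in H | f \in EM m) 1)%N.
  move=> mM; rewrite -(card_imset _ (comp_vmap_inj (s := t) (M_inj m mM))).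
  rewrite -sum1_card; apply: eq_bigl => f; apply/idP/andP => [fE|[]//].
  by split=> //; case/imsetP: fE => e eE ->; apply: EMH.
rewrite (eq_bigr _ cardEM).
rewrite (exchange_big_dep (mem H)) /=; last by move=> ? ? _ /andP[].
apply: eq_bigr => f fH; rewrite sum1_card; apply: eq_card => m.
rewrite [LHS]inE fH /=; apply/andP/idP.
  by case=> mM /imsetP[e eE ef]; apply/(EmbE f fH); split=> //; exists e.
by case/(EmbE f fH) => mM [e eE <-]; split=> //; apply: imset_f.
Qed.

Local Open Scope ring_scope.

(** Only the class of the subgraph [(A, D)] has embeddings onto it, and its term is |Aut| /
    |Aut|. *)
Lemma sum_card_Emb (t : graph) (A : {set vertex t}) (D : {set {set vertex t}})
    (r : seq graph_class) :
    D \subset edges t -> {in D, forall e : {set vertex t}, e \subset A} ->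
    uniq r ->
    (forall (s : graph_class) f, f \in Emb (repr s) A D -> s \in r) ->
  \sum_(s <- r) (#|Emb (repr s) A D|%:R / (n_aut s)%:R) = 1 :> rat.
Proof.
move=> DE DA r_uniq rP; have [s [f fE]] := Emb_exists DE DA.
rewrite (bigD1_seq s) ?(rP s f) //= big1 => [|s' s's].
  rewrite addr0 (card_Emb fE) divff // Num.Theory.pnatr_eq0 -lt0n.
  exact: card_Aut_gt0.
rewrite (_ : #|_| = 0%N) ?mul0r //; apply: eq_card0 => g; apply: contraNF s's.
move=> gE; apply/eqP; rewrite -[s']reprK -[s]reprK; apply/eqmodP.
exact: Emb_isomorphic gE fE.
Qed.

(** Once the sums over classes and over [f] are exchanged, each [f] in [H] contributes 1 by
    [sum_card_Emb]. *)
Lemma sum_factorizations (t u : graph_class) (r : seq graph_class)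
    (E : forall s : graph_class, {set vmap (repr t) (repr s)})
    (M : forall s : graph_class, {set vmap (repr s) (repr u)})
    (H : {set vmap (repr t) (repr u)})
    (D : vmap (repr t) (repr u) -> {set {set vertex (repr u)}}) :
    uniq r -> (forall s e, e \in E s -> s \in r) ->
    {in H, forall f, D f \subset edges (repr u)} ->
    {in H, forall f,
       {in D f, forall e : {set vertex (repr u)}, e \subset vertex_image f}} ->
    (forall s, {in M s, forall m : vmap _ _, injective m}) ->
    (forall s, {in E s & M s, forall e m, comp_vmap e m \in H}) ->
    (forall s, {in H, forall f m, m \in Emb (repr s) (vertex_image f) (D f) <->
       m \in M s /\ exists2 e, e \in E s & comp_vmap e m = f}) ->
  \sum_(s <- r) (#|E s|%:R / (n_aut s)%:R * #|M s|%:R) = #|H|%:R :> rat.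
Proof.
move=> r_uniq rP DE DV M_inj EMH EmbE.
under eq_bigr => s _ do rewrite mulrAC -natrM
  (card_factorizations (M_inj s) (EMH s) (EmbE s)) natr_sum mulr_suml.
rewrite exchange_big /= -sum1_card natr_sum; apply: eq_bigr => f fH.
apply: sum_card_Emb; [exact: DE | exact: DV | exact: r_uniq | move=> s m].
(* An embedding of [s] onto the subgraph yields some [e] in [E s], which places [s] in [r]. *)
by case/(EmbE s f fH) => _ [e /rP].
Qed.

(** * Finite supports and linear extension *)

Definition small_classes (n : nat) : seq graph_class :=
  undup [seq \pi_graph_class (Tagged graph_on g : graph)
           | k <- iota 0 n.+1, g <- enum {: graph_on k}].

(** A surjection cannot increase the number of vertices, so this list carries the support of both
    sums over classes. *)
Lemma mem_small_classes (s t : graph_class) (f : vmap (repr t) (repr s)) :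
  vertex_image f = [set: vertex (repr s)] ->
  s \in small_classes (tag (repr t)).
Proof.
move=> fT; rewrite mem_undup; apply/allpairsPdep.
exists (tag (repr s)), (tagged (repr s)); rewrite mem_iota mem_enum ltnS; split=> //.
  have := leq_imset_card f [set: vertex (repr t)].
  by rewrite -/(vertex_image f) fT !cardsT !card_ord.
rewrite -[LHS]reprK; congr (\pi _); by case: (repr s).
Qed.

Lemma lin_ext_basis (M : lmodType rat) (f : graph_class -> M) (s : graph_class) :
  lin_ext f (basis s) = f s.
Proof. by rewrite /lin_ext /basis liftU scale1r. Qed.

Lemma eq_on_basis (M : lmodType rat) (f g : {linear QG -> M}) :
  (forall s, f (basis s) = g (basis s)) -> f =1 g.
Proof.
move=> fg x; have -> : x = \sum_(s <- dom x) coeff s x *: basis s.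
  rewrite -[LHS]freeg_sumE; apply: eq_bigr => s _.
  by apply/eqP/freeg_eqP => z; rewrite coeffZ !coeffU mul1r.
by rewrite !linear_sum; apply: eq_bigr => s _; rewrite !linearZ fg.
Qed.

(** Linearity applies to sums over lists, so the finitely supported sum is first rewritten over a
    list containing its support. *)
Lemma pairing_fsum (phi : functional) (c : graph_class -> rat)
    (r : seq graph_class) :
    uniq r -> (forall s, c s != 0 -> s \in r) ->
  pairing phi (\sum_(s \in [set: graph_class]%classic) c s *: basis s)
    = \sum_(s <- r) c s * pairing phi (basis s).
Proof.
move=> r_uniq rP; rewrite (fsbigE r) //; last first.
  move=> s _ /negP sr; have [->|/rP//] := eqVneq (c s) 0.
  exact: scale0r.
rewrite big_mkcond /pairing linear_sum; apply: eq_bigr => s _.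
by rewrite classical_sets.in_setT linearZ.
Qed.

(** * Factorizations of monomorphisms and homomorphisms *)

Lemma comp_vmap_eq_inj (s t u : graph) (e : vmap s t) (m : vmap t u) :
  injective (comp_vmap e m) -> injective e.
Proof. by move=> f_inj x y exy; apply: f_inj; rewrite !ffunE exy. Qed.

Lemma MonoP (s t : graph) (f : vmap s t) :
  reflect (injective f /\ edge_image f \subset edges t) (f \in Mono s t).
Proof.
rewrite !inE andbC; apply: (iffP andP) => [[/injectiveP]|[f_inj]] //.
by split=> //; apply/injectiveP.
Qed.

Lemma MonoEpiP (s t : graph) (f : vmap s t) :
  reflect [/\ injective f, vertex_image f = [set: vertex t]
             & edge_image f \subset edges t]
          (f \in Mono s t :&: Epi s t).
Proof.
rewrite inE; apply: (iffP andP) => [[/MonoP[f_inj fE]]|[f_inj fT fE]].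
  by rewrite !inE => /andP[_ /eqP].
by split; [apply/MonoP | rewrite !inE fE fT eqxx].
Qed.

Lemma RegEpiP (s t : graph) (f : vmap s t) :
  reflect (vertex_image f = [set: vertex t] /\ edge_image f = edges t)
          (f \in RegEpi s t).
Proof.
rewrite !inE; apply: (iffP andP) => [[/andP[_ /eqP ? /eqP ?]]|[-> ->]] //.
by rewrite !eqxx subxx.
Qed.

Lemma RegMonoP (s t : graph) (f : vmap s t) :
  reflect (injective f /\ edge_image f = edges t ::&: vertex_image f)
          (f \in RegMono s t).
Proof.
rewrite inE; apply: (iffP andP) => [[/injectiveP ? /eqP]|[? ->]] //.
by split=> //; apply/injectiveP.
Qed.

(** For surjectivity of [e]: [m] sends both the image of [e] and the whole of [t] onto the image of
    [f], and [m] cancels. *)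
Lemma Emb_factor (s t u : graph) (f : vmap s u) (m : vmap t u)
    (D : {set {set vertex u}}) :
    m \in Emb t (vertex_image f) D ->
  exists2 e : vmap s t, comp_vmap e m = f & vertex_image e = [set: vertex t].
Proof.
case/EmbP => m_inj mV _; have [|e ef] := @factor_through s t u f m.
  by rewrite mV.
exists e => //; apply: (imset_inj m_inj).
by rewrite -vertex_image_comp ef -mV.
Qed.

(** The induced subgraph may have more edges than [f] hits, so [e] is bijective on vertices but
    possibly not onto edges. *)
Lemma Emb_mono_factorization (s t u : graph) (f : vmap s u) (m : vmap t u) :
  f \in Mono s u ->
  m \in Emb t (vertex_image f) (edges u ::&: vertex_image f) <->
  m \in RegMono t u /\ exists2 e, e \in Mono s t :&: Epi s t & comp_vmap e m = f.
Proof.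
case/MonoP => f_inj fE; split=> [mE|[/RegMonoP[m_inj mE] [e]]].
  have [e ef eT] := Emb_factor mE; case/EmbP: mE => m_inj mV mE.
  split; first by apply/RegMonoP; rewrite mV.
  exists e => //; apply/MonoEpiP; split=> //.
    by apply: (@comp_vmap_eq_inj _ _ _ e m); rewrite ef.
  (* Membership of [d] in [edges t] is tested after applying [m], where it means being an edge of
     [u] inside the image of [f]. *)
  apply/subsetP => d dE; rewrite -(mem_imset _ _ (imset_inj m_inj)).
  rewrite -/(edge_image m) mE inE -ef.
  have : m @: (d : {set vertex t}) \in edge_image f.
    by rewrite -ef edge_image_comp; apply: imset_f.
  by rewrite ef => df; rewrite (subsetP fE) ?edge_image_sub.
case/MonoEpiP => _ eT _ ef.
have fV : vertex_image f = vertex_image m by rewrite -ef vertex_image_comp eT.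
by apply/EmbP; rewrite fV.
Qed.

(** Here [m] hits exactly the edges hit by [f]; cancelling [m] on sets of edges shows that [e] is
    onto edges. *)
Lemma Emb_hom_factorization (s t u : graph) (f : vmap s u) (m : vmap t u) :
  f \in Hom s u ->
  m \in Emb t (vertex_image f) (edge_image f) <->
  m \in Mono t u /\ exists2 e, e \in RegEpi s t & comp_vmap e m = f.
Proof.
rewrite inE => fE; split=> [mE|[/MonoP[m_inj mE] [e]]].
  have [e ef eT] := Emb_factor mE; case/EmbP: mE => m_inj mV mE.
  split; first by apply/MonoP; rewrite mE.
  exists e => //; apply/RegEpiP; split=> //.
  by apply: (imset_inj (imset_inj m_inj)); rewrite -edge_image_comp ef -mE.
case/RegEpiP => eT eE <-.
by apply/EmbP; rewrite vertex_image_comp edge_image_comp eT eE.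
Qed.

Lemma comp_Hom (s t u : graph) (e : vmap s t) (m : vmap t u) :
  e \in Hom s t -> m \in Hom t u -> comp_vmap e m \in Hom s u.
Proof.
rewrite !inE edge_image_comp => eE; apply: subset_trans; exact: imsetS.
Qed.

Lemma comp_Mono (s t u : graph) (e : vmap s t) (m : vmap t u) :
  e \in Mono s t -> m \in Mono t u -> comp_vmap e m \in Mono s u.
Proof.
rewrite ![_ \in Mono _ _]inE => /andP[eH /injectiveP e_inj].
case/andP => mH /injectiveP m_inj; rewrite comp_Hom //.
by apply/injectiveP => x y; rewrite !ffunE => /m_inj/e_inj.
Qed.

Lemma RegMono_sub_Mono (s t : graph) : RegMono s t \subset Mono s t.
Proof.
apply/subsetP => f /RegMonoP[f_inj fE]; apply/MonoP; split=> //.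
by apply/subsetP => e; rewrite fE inE => /andP[].
Qed.

Lemma card_div_neq0 (T : finType) (A : {set T}) (c : rat) :
  (#|A|%:R / c != 0) -> exists x, x \in A.
Proof.
move=> A0; apply/card_gt0P; rewrite lt0n.
by apply: contraNneq A0 => ->; rewrite mul0r.
Qed.

(** * The six identities *)

Lemma regmono_mono_basis (t L : graph_class) :
  pairing (GC_mono L) (basis t)
    = pairing (GC_regmono L) (Phi_regmono_mono (basis t)).
Proof.
have r_uniq : uniq (small_classes (tag (repr t))) by exact: undup_uniq.
rewrite [Phi_regmono_mono _]lin_ext_basis (pairing_fsum _ r_uniq); last first.
  by move=> s /card_div_neq0[e /MonoEpiP[_ /mem_small_classes]].
under eq_bigr => s _ do rewrite [pairing _ _]lin_ext_basis.
rewrite [LHS]lin_ext_basis; apply/esym.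
apply: (@sum_factorizations t L _
  (fun s => Mono (repr t) (repr s) :&: Epi (repr t) (repr s))
  (fun s => RegMono (repr s) (repr L)) (Mono (repr t) (repr L))
  (fun f => edges (repr L) ::&: vertex_image f)).
- exact: r_uniq.
- by move=> s e /MonoEpiP[_ /mem_small_classes].
- by move=> f _; apply/subsetP => e; rewrite inE => /andP[].
- by move=> f _ e; rewrite inE => /andP[].
- by move=> s m /RegMonoP[].
- move=> s e m /setIP[eM _] mM; apply: comp_Mono eM _.
  exact: (subsetP (RegMono_sub_Mono _ _)).
- by move=> s f fM m; apply: Emb_mono_factorization.
Qed.

Lemma mono_hom_basis (t L : graph_class) :
  pairing (GC_hom L) (basis t) = pairing (GC_mono L) (Phi_mono_hom (basis t)).
Proof.
have r_uniq : uniq (small_classes (tag (repr t))) by exact: undup_uniq.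
rewrite [Phi_mono_hom _]lin_ext_basis (pairing_fsum _ r_uniq); last first.
  by move=> s /card_div_neq0[e /RegEpiP[/mem_small_classes]].
under eq_bigr => s _ do rewrite [pairing _ _]lin_ext_basis.
rewrite [LHS]lin_ext_basis; apply/esym.
apply: (@sum_factorizations t L _ (fun s => RegEpi (repr t) (repr s))
  (fun s => Mono (repr s) (repr L)) (Hom (repr t) (repr L)) (@edge_image _ _)).
- exact: r_uniq.
- by move=> s e /RegEpiP[/mem_small_classes].
- by move=> f; rewrite inE.
- by move=> f _ e; apply: edge_image_sub.
- by move=> s m /MonoP[].
- move=> s e m; rewrite !inE => /andP[/andP[eH _] _] /andP[mH _].
  by have := @comp_Hom _ _ _ e m; rewrite !inE; apply.
- by move=> s f fM m; apply: Emb_hom_factorization.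
Qed.

(** One computation gives all three primed identities, with [g] counting each kind of morphism; the
    automorphism count is nonzero and cancels. *)
Lemma lin_ext_div_aut (g : graph_class -> nat) (t : graph_class) :
  lin_ext (fun s => (g s)%:R : rat^o) (basis t)
    = lin_ext (fun s => (g s)%:R / (n_aut s)%:R : rat^o)
        (Phi_hom'_hom (basis t)).
Proof.
rewrite [Phi_hom'_hom _]lin_ext_basis linearZ.
rewrite -[RHS]/((n_aut t)%:R * lin_ext _ _) !lin_ext_basis.
rewrite mulrCA divff ?mulr1 // Num.Theory.pnatr_eq0 -lt0n; exact: card_Aut_gt0.
Qed.

Theorem theorem3p26 (t L : graph_class) :
  [/\ pairing (GC_mono L) (basis t)
        = pairing (GC_regmono L) (Phi_regmono_mono (basis t)),
      pairing (GC_hom L) (basis t)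
        = pairing (GC_mono L) (Phi_mono_hom (basis t)),
      pairing (GC_hom L) (basis t)
        = pairing (GC_regmono L)
            ((Phi_regmono_mono \o Phi_mono_hom) (basis t)) &
    [/\ pairing (GC_hom L) (basis t)
        = pairing (GC_hom' L) (Phi_hom'_hom (basis t)),
      pairing (GC_mono L) (basis t)
        = pairing (GC_mono' L) (Phi_mono'_mono (basis t)) &
      pairing (GC_regmono L) (basis t)
        = pairing (GC_regmono' L) (Phi_regmono'_regmono (basis t))]].
Proof.
split; [exact: regmono_mono_basis | exact: mono_hom_basis | | ].
  rewrite mono_hom_basis.
  (* [Phi_mono_hom (basis t)] is a combination of basis vectors, so the first identity is extended
     linearly before it is applied there. *)
  apply: (@eq_on_basis _ (GC_mono L) (GC_regmono L \o Phi_regmono_mono)) => s.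
  exact: regmono_mono_basis.
by split; apply: lin_ext_div_aut.
Qed.
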